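(* Let ${\bm U}(t),{\bm Q}(t)\in\mathbb{V}_h$ be a solution of the semi-discrete system $$\frac{d}{dt}{\bm U}={\bm D}\Big({\bm Q}-{\bm U}^2+{\bm D}_1\big(({\bm D}_1{\bm U})\cdot{\bm U}\big)\Big),\qquad \frac{d}{dt}{\bm Q}=-{\bm U}\cdot\frac{d}{dt}{\bm U}-({\bm D}_1{\bm U})\cdot\Big({\bm D}_1\frac{d}{dt}{\bm U}\Big),$$ where ${\bm D}=({\bm I}-{\bm D}_2)^{-1}{\bm D}_1$. Then the semi-discrete quadratic energy $E=\langle{\bm U},{\bm Q}\rangle_h$ is preserved: $$\frac{d}{dt}E=0 .$$
   Context: $\Omega=[a,a+L]$, $N$ is an even positive integer, $h=L/N$, $x_j=a+jh$, $\mu=2\pi/L$. $\mathbb{V}_h$ is the space of real vectors ${\bm U}=(U_0,\dots,U_{N-1})^T$, identified with $N$-periodic mesh functions ($U_{j+N}=U_j$), with inner product $\langle{\bm U},{\bm V}\rangle_h=h\sum_{j=0}^{N-1}U_jV_j$. The symbol $\cdot$ denotes the componentwise product of vectors, and ${\bm U}^2={\bm U}\cdot{\bm U}$. Fourier pseudo-spectral differentiation matrices: let $g_j(x)=\frac1N\sum_{l=-N/2}^{N/2}\frac1{a_l}e^{\mathrm{i}l\mu(x-x_j)}$, with $a_l=1$ for $|l|<N/2$ and $a_l=2$ for $|l|=N/2$. For $s=1,2$, ${\bm D}_s$ is the $N\times N$ matrix with entries $({\bm D}_s)_{j,k}=\frac{d^sg_k}{dx^s}(x_j)$, $j,k=0,\dots,N-1$.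 ${\bm D}_1$ is real skew-symmetric and ${\bm D}_2$ is real symmetric; with the discrete Fourier transform matrix $({\bm F}_N)_{j,k}=\frac1{\sqrt N}e^{-\mathrm{i}jk2\pi/N}$ and its conjugate transpose ${\bm F}_N^H$ one has ${\bm D}_1={\bm F}_N^H\Lambda_1{\bm F}_N$, $\Lambda_1=\mathrm{i}\mu\,\mathrm{diag}(0,1,\dots,\frac N2-1,0,-\frac N2+1,\dots,-1)$, and ${\bm D}_2={\bm F}_N^H\Lambda_2{\bm F}_N$, $\Lambda_2=[\mathrm{i}\mu\,\mathrm{diag}(0,1,\dots,\frac N2-1,\frac N2,-\frac N2+1,\dots,-1)]^2$. ${\bm I}$ is the $N\times N$ identity matrix. *)

(* Defs.v *)
From HB Require Import structures.
From mathcomp Require Import all_boot all_order all_algebra.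
From mathcomp Require Import all_classical all_reals all_analysis.
From mathcomp Require Import complex.

Set Implicit Arguments.
Unset Strict Implicit.
Unset Printing Implicit Defensive.
Import Order.TTheory GRing.Theory Num.Theory.
Import numFieldNormedType.Exports.
Local Open Scope classical_set_scope.
Local Open Scope ring_scope.

Section Fourier.
Context {R : realType}.

Definition expi (theta : R) : R[i] := Complex (cos theta) (sin theta).

Variables (a L : R) (N : nat).

Definition step : R := L / N%:R.
Definition node (j : nat) : R := a + j%:R * step.
Definition mu : R := 2 * pi / L.

Definition weight (l : int) : R := if `|l|%N == N./2 then 2 else 1.

(* With N even, l = m - N/2 runs over -N/2, ..., N/2 as m runs over 0, ..., N. *)
Definition freq (m : nat) : int := m%:Z - (N./2)%:Z.

Definition trig_basis (k : nat) (x : R) : R[i] :=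
  (N%:R)^-1 * \sum_(m < N.+1)
    ((weight (freq m))^-1)%:C%C * expi ((freq m)%:~R * mu * (x - node k)).

Lemma Im_trig_basis (k : nat) (x : R) :
  ~~ odd N -> complex.Im (trig_basis k x) = 0.
Proof.
move=> evN; have N2 : N = (N./2 + N./2)%N.
  by rewrite addnn -[LHS](odd_double_half N) (negbTE evN).
have ImM (r : R) (z : R[i]) : complex.Im (r%:C%C * z) = r * complex.Im z.
  by case: z => u v /=; rewrite mul0r addr0.
rewrite /trig_basis; have -> : (N%:R : R[i])^-1 = ((N%:R : R)^-1)%:C%C.
  by rewrite fmorphV rmorph_nat.
rewrite ImM (big_morph (@complex.Im R) (id1 := 0) (op1 := +%R)) //; last first.
  by case=> u v; case=> u' v'.
under eq_bigr => m _ do rewrite ImM /=.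
suff sum_odd (S : R) : S = - S -> N%:R^-1 * S = 0.
  apply: sum_odd; rewrite [LHS](reindex_inj rev_ord_inj) /= -sumrN.
  apply: eq_bigr => m _; have -> : freq (N.+1 - m.+1) = - freq m.
    by rewrite /freq subSS -subzn ?leq_ord // {1}N2 PoszD opprB addrAC addrK.
  by rewrite /weight abszN rmorphN /= !mulNr sinN mulrN.
by move/eqP; rewrite -subr_eq0 opprK -mulr2n mulrn_eq0 /= => /eqP ->; rewrite mulr0.
Qed.

(* The k-th basis function is real-valued (Im_trig_basis), so its derivatives are
   those of its real part. *)
Definition diff_mx (s : nat) : 'M[R]_N :=
  \matrix_(j < N, k < N) derive1n s (fun x : R => complex.Re (trig_basis k x)) (node j).

(* invmx is the inverse because 1 - D_2, with eigenvalues 1 + mu^2 l^2, is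
   nonsingular. *)
Definition D_mx : 'M[R]_N := invmx (1%:M - diff_mx 2) *m diff_mx 1.

Definition inner_h (U V : 'cV[R]_N) : R := step * \sum_(j < N) U j 0 * V j 0.

Definition cmul (U V : 'cV[R]_N) : 'cV[R]_N := map2_mx *%R U V.

End Fourier.

(* Main.v *)
(* The entries of D_1 and D_2 depend only on x_j - x_k, through an odd,
   respectively even, L-periodic function. Hence D_1 is skew, D_2 is symmetric, and
   both are circulant, so they commute and D = (1 - D_2)^-1 D_1 is skew.
   Substituting the equation for Q' and moving D_1 across the inner product gives
   E' = <U', W> with W = Q - U^2 + D_1 ((D_1 U) U); since U' = D W, this is
   <D W, W> = 0. *)

Require Import Defs.
From mathcomp Require Import all_boot all_order all_algebra.
From mathcomp Require Import all_classical all_reals all_analysis.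
From mathcomp Require Import complex.
From mathcomp Require Import ring zify.
Import Order.TTheory GRing.Theory Num.Theory.
Import numFieldNormedType.Exports.
Local Open Scope classical_set_scope.
Local Open Scope ring_scope.

(** Each step compares limits of the same difference quotient. This reduces all columns of a
    differentiation matrix to translates of one kernel. *)
Lemma derive1n_shift (R : realType) (s : nat) (f : R -> R) (c x : R) :
  derive1n s (fun y => f (y - c)) x = derive1n s f (x - c).
Proof.
elim: s x => [//|s IH] x.
rewrite !derive1nS (_ : derive1n s _ = (fun y => derive1n s f (y - c))); last first.
  exact/funext.
by rewrite /derive1; under eq_fun do rewrite -addrA.
Qed.

(** A shape stable under differentiation: a derivative only changes the weights and [phi], so parity
    and periodicity are settled once for all orders. *)
Definition harmonic_sum {R : realType} {n : nat} (c w : 'I_n -> R)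
  (phi : R -> R) (y : R) : R := \sum_(m < n) w m * phi (c m * y).

Section HarmonicSum.
Context {R : realType} {n : nat}.
Variables (c w : 'I_n -> R) (phi : R -> R).

Lemma derive1_harmonic_sum (dphi : R -> R) :
  (forall x : R, is_derive x 1 phi (dphi x)) ->
  derive1 (harmonic_sum c w phi) =
  harmonic_sum c (fun m => w m * c m) dphi.
Proof.
move=> dphiE; apply/funext => y; rewrite derive1E.
suff H : is_derive y (1 : R) (harmonic_sum c w phi)
    (harmonic_sum c (fun m => w m * c m) dphi y) by exact: derive_val.
have -> : harmonic_sum c w phi = \sum_(m < n) (w m \*: (phi \o (c m \*: id))).
  by apply/funext => z; rewrite fct_sumE.
apply: is_derive_eq; rewrite /harmonic_sum; apply: eq_bigr => m _.
by rewrite [c m *: 1]mulr1 -mulrA [c m * _]mulrC.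
Qed.

(** The sign [e] is [- 1] for the sine kernel and [1] for the cosine one. *)
Lemma harmonic_sumN (e : R) : (forall x, phi (- x) = e * phi x) ->
  forall y, harmonic_sum c w phi (- y) = e * harmonic_sum c w phi y.
Proof.
move=> phiN y; rewrite mulr_sumr; apply: eq_bigr => m _.
by rewrite mulrN phiN mulrCA.
Qed.

Lemma harmonic_sum_periodic (L p : R) (l : 'I_n -> int) :
  periodic phi p -> (forall m, c m * L = p *~ l m) ->
  periodic (harmonic_sum c w phi) L.
Proof.
move=> phip cL y; apply: eq_bigr => m _; congr (_ * _).
rewrite mulrDr cL; case: (l m) => k; first exact: periodicn.
(* For a negative multiple, adding back [k.+1] periods undoes the shift. *)
by rewrite NegzE mulrNz -[LHS](periodicn phip k.+1) subrK.
Qed.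

End HarmonicSum.

Section Kernel.
Context {R : realType}.
Variables (a L : R) (N : nat).

Let c (m : 'I_N.+1) : R := (freq N m)%:~R * mu L.

Let w (m : 'I_N.+1) : R := N%:R^-1 * (weight N (freq N m))^-1.

(** The coefficients are real, so only cosines survive; [k] enters through the translation alone,
    the source of the circulant structure. *)
Lemma Re_trig_basis (k : nat) :
  (fun x => complex.Re (trig_basis a L N k x)) =
  (fun x => harmonic_sum c w cos (x - node a L N k)).
Proof.
apply/funext => x.
have ReM (r : R) (z : R[i]) : complex.Re (r%:C%C * z) = r * complex.Re z.
  by case: z => u v /=; rewrite mul0r subr0.
rewrite /trig_basis; have -> : (N%:R : R[i])^-1 = ((N%:R : R)^-1)%:C%C.
  by rewrite fmorphV rmorph_nat.
rewrite ReM (big_morph (@complex.Re R) (id1 := 0) (op1 := +%R)) //; last first.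
  by case=> u v; case=> u' v'.
by rewrite mulr_sumr; apply: eq_bigr => m _; rewrite ReM mulrA.
Qed.

(** These are the first and second derivatives of the cosine kernel [harmonic_sum c w cos]. *)
Definition dkernel1 := harmonic_sum c (fun m => w m * c m) (fun x => - sin x).
Definition dkernel2 :=
  harmonic_sum c (fun m => w m * c m * c m) (fun x => - cos x).

Lemma diff_mx1E (j k : 'I_N) :
  diff_mx a L N 1 j k = dkernel1 (node a L N j - node a L N k).
Proof.
rewrite mxE Re_trig_basis derive1n_shift /=.
by rewrite (derive1_harmonic_sum _ _ _ (fun x => - sin x)).
Qed.

Lemma diff_mx2E (j k : 'I_N) :
  diff_mx a L N 2 j k = dkernel2 (node a L N j - node a L N k).
Proof.
rewrite mxE Re_trig_basis derive1n_shift /=.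
rewrite (derive1_harmonic_sum _ _ _ (fun x => - sin x)).
by rewrite (derive1_harmonic_sum _ _ _ (fun x => - cos x)).
Qed.

Lemma diff_mx1_skew : (diff_mx a L N 1)^T = - diff_mx a L N 1.
Proof.
apply/matrixP => j k; rewrite mxE [RHS]mxE !diff_mx1E -opprB.
rewrite /dkernel1 (harmonic_sumN _ _ _ (- 1)) ?mulN1r //.
by move=> x; rewrite sinN mulN1r.
Qed.

Lemma diff_mx2_sym : (diff_mx a L N 2)^T = diff_mx a L N 2.
Proof.
apply/matrixP => j k; rewrite mxE !diff_mx2E -opprB.
rewrite /dkernel2 (harmonic_sumN _ _ _ 1) ?mul1r //.
by move=> x; rewrite cosN mul1r.
Qed.

Let harmonics_L m : L != 0 -> c m * L = (pi *+ 2) *~ freq N m.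
Proof.
move=> L_neq0; rewrite /c -mulrA /mu divfK // -[RHS]mulrzl.
congr (_ * _).
by rewrite mulr_natl.
Qed.

Lemma dkernel1_periodic : L != 0 -> periodic dkernel1 L.
Proof.
move=> L_neq0; apply: (harmonic_sum_periodic _ _ _ _ (pi *+ 2) (freq N)).
  by move=> x; rewrite sinD2pi.
by move=> m; exact: harmonics_L.
Qed.

Lemma dkernel2_periodic : L != 0 -> periodic dkernel2 L.
Proof.
move=> L_neq0; apply: (harmonic_sum_periodic _ _ _ _ (pi *+ 2) (freq N)).
  by move=> x; rewrite cosD2pi.
by move=> m; exact: harmonics_L.
Qed.

End Kernel.

(** On the right [j - k] is taken modulo [n.+1]. It differs from the integer difference by [0] or
    [n.+1], and [n.+1] steps make one period [L]. *)
Lemma periodic_node_diff (R : realType) (a L : R) (n : nat) (f : R -> R)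
    (j k : 'I_n.+1) : periodic f L ->
  f (node a L n.+1 j - node a L n.+1 k) =
  f (node a L n.+1 (j - k)%R - node a L n.+1 0).
Proof.
move=> fL.
have nodeB (p q : nat) : node a L n.+1 p - node a L n.+1 q =
    (p%:R - q%:R) * step L n.+1 by rewrite /node; ring.
rewrite !nodeB subr0.
have [lekj|ltjk] := leqP k j.
  have -> : (nat_of_ord (j - k)%R = j - k)%N.
    rewrite /= modnDmr addnBA ?(ltnW (ltn_ord k)) // addnC -addnBA //.
    by rewrite modnDl modn_small // (leq_ltn_trans (leq_subr _ _)).
  by rewrite natrB.
have -> : (nat_of_ord (j - k)%R = n.+1 + j - k)%N.
  rewrite /= modnDmr addnBA ?(ltnW (ltn_ord k)) // (addnC j) modn_small //.
  lia.
rewrite natrB ?(leq_trans (ltnW (ltn_ord k))) ?leq_addr // natrD.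
rewrite -[LHS]fL; congr (f _); rewrite /step.
by field; rewrite nat1r pnatr_eq0.
Qed.

(** The product is a convolution over a cyclic group; the substitution of [j + k - m] for [m] swaps
    the two factors. *)
Lemma circulant_mulC (R : comPzRingType) (n : nat) (u v : 'I_n.+1 -> R) :
  (\matrix_(j, k) u (j - k)) *m (\matrix_(j, k) v (j - k)) =
  (\matrix_(j, k) v (j - k)) *m (\matrix_(j, k) u (j - k)).
Proof.
apply/matrixP => j k; rewrite !mxE.
rewrite (reindex_inj (inj_comp (addrI (j + k)) oppr_inj)) /=.
apply: eq_bigr => m _; rewrite !mxE mulrC; congr (v _ * u _).
  by rewrite addrAC addrK.
by rewrite !opprD opprK !addrA subrr add0r addrC.
Qed.

Lemma diff_mxC (R : realType) (a L : R) (N : nat) : L != 0 ->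
  diff_mx a L N 1 *m diff_mx a L N 2 = diff_mx a L N 2 *m diff_mx a L N 1.
Proof.
(* Index subtraction needs the cyclic group ['I_n.+1]; for [N = 0] the matrices are empty. *)
move=> L_neq0; case: N => [|n]; first by apply/matrixP => -[].
have circ (A : 'M[R]_n.+1) (f : R -> R) : periodic f L ->
    (forall j k, A j k = f (node a L n.+1 j - node a L n.+1 k)) ->
    A = \matrix_(j, k) f (node a L n.+1 (j - k)%R - node a L n.+1 0).
  by move=> fL AE; apply/matrixP => j k; rewrite AE mxE periodic_node_diff.
rewrite (circ _ _ (dkernel1_periodic _ _ L_neq0) (diff_mx1E a L _)).
rewrite (circ _ _ (dkernel2_periodic _ _ L_neq0) (diff_mx2E a L _)).
exact: (circulant_mulC R n
  (fun i => dkernel1 L n.+1 (node a L n.+1 i - node a L n.+1 0))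
  (fun i => dkernel2 L n.+1 (node a L n.+1 i - node a L n.+1 0))).
Qed.

(* Holds also in the junk case of a singular [B], where [invmx B = B]. *)
Lemma mulmx_invmx_skew (R : comUnitRingType) (n : nat) (A B : 'M[R]_n) :
  A^T = - A -> B^T = B -> A *m B = B *m A ->
  (invmx B *m A)^T = - (invmx B *m A).
Proof.
move=> skewA symB AB; rewrite trmx_mul trmx_inv skewA symB mulNmx; congr (- _).
have [uB|nuB] := boolP (B \in unitmx); last by rewrite invmx_out.
(* [A] commutes with the inverse of [B]: multiply by [B *m invmx B] on the right, then move [A] past
   [B]. *)
by rewrite -[RHS](mulmxK uB) -(mulmxA _ A) AB (mulmxA _ B) mulVmx // mul1mx.
Qed.

Lemma D_mx_skew (R : realType) (a L : R) (N : nat) : L != 0 ->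
  (D_mx a L N)^T = - D_mx a L N.
Proof.
move=> L_neq0; apply: mulmx_invmx_skew; first exact: diff_mx1_skew.
  by rewrite linearB /= trmx1 diff_mx2_sym.
by rewrite mulmxBr mulmxBl mulmx1 mul1mx diff_mxC.
Qed.

Section InnerProduct.
Context {R : realType} {N : nat} (L : R).
Implicit Types U V W : 'cV[R]_N.

Lemma inner_hC U V : inner_h L U V = inner_h L V U.
Proof. by congr (_ * _); apply: eq_bigr => j _; rewrite mulrC. Qed.

Lemma inner_hDr U V W : inner_h L U (V + W) = inner_h L U V + inner_h L U W.
Proof.
rewrite -mulrDr -big_split; congr (_ * _).
by apply: eq_bigr => j _; rewrite mxE mulrDr.
Qed.

Lemma inner_hNr U V : inner_h L U (- V) = - inner_h L U V.
Proof.
rewrite -mulrN -sumrN; congr (_ * _).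
by apply: eq_bigr => j _; rewrite mxE mulrN.
Qed.

Lemma inner_h_cmul U V W : inner_h L U (cmul V W) = inner_h L (cmul V U) W.
Proof.
by congr (_ * _); apply: eq_bigr => j _; rewrite !mxE mulrCA mulrA.
Qed.

Lemma cmulC U V : cmul U V = cmul V U.
Proof. by apply/matrixP => i j; rewrite !mxE mulrC. Qed.

Lemma inner_h_skew (A : 'M[R]_N) U V : A^T = - A ->
  inner_h L U (A *m V) = - inner_h L V (A *m U).
Proof.
move=> skewA; rewrite -inner_hNr -mulNmx -skewA; congr (_ * _).
under eq_bigr do rewrite mxE mulr_sumr.
rewrite exchange_big; apply: eq_bigr => j _; rewrite mxE mulr_sumr.
by apply: eq_bigr => i _; rewrite mxE; ring.
Qed.

Lemma inner_h_skew0 (A : 'M[R]_N) U : A^T = - A -> inner_h L U (A *m U) = 0.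
Proof.
move=> skewA; have /eqP := inner_h_skew A U U skewA.
by rewrite -addr_eq0 -mulr2n mulrn_eq0 => /eqP.
Qed.

(** Derivatives of column-valued functions are entrywise, so this is the scalar product rule summed
    over the entries. *)
Lemma is_derive_inner_h (U V : R -> 'cV[R]_N) t :
  derivable U t 1 -> derivable V t 1 ->
  is_derive t (1 : R) (fun s => inner_h L (U s) (V s))
    (inner_h L (derive1 U t) (V t) + inner_h L (U t) (derive1 V t)).
Proof.
move=> dU dV.
have der (W : R -> 'cV[R]_N) : derivable W t 1 ->
    forall j, is_derive t 1 (fun s => W s j 0) (derive1 W t j 0).
  move=> dW j; rewrite derive1E derive_mx // mxE.
  by apply: derivableP; move/derivable_mxP: dW; apply.
have -> : (fun s => inner_h L (U s) (V s)) = step L N \*: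
    (\sum_(j < N) ((fun s => U s j 0) * (fun s => V s j 0))).
  by apply/funext => s; rewrite /= fct_sumE.
have dUj j := der _ dU j; have dVj j := der _ dV j.
apply: is_derive_eq; rewrite /inner_h -mulrDr -big_split; congr (_ * _).
by apply: eq_bigr => j _; rewrite addrC [_ *: derive1 U t _ _]mulrC.
Qed.

End InnerProduct.

Theorem theorem3p1 (R : realType) (a L : R) (N : nat)
    (L_gt0 : 0 < L) (N_gt0 : (0 < N)%N) (N_even : ~~ odd N)
    (J : interval R) (U Q : R -> 'cV[R]_N)
    (derU : forall t : R, t \in J -> derivable U t 1)
    (derQ : forall t : R, t \in J -> derivable Q t 1)
    (eqU : forall t : R, t \in J ->
       derive1 U t = D_mx a L N *m
         (Q t - cmul (U t) (U t)
          + diff_mx a L N 1 *m cmul (diff_mx a L N 1 *m U t) (U t)))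
    (eqQ : forall t : R, t \in J ->
       derive1 Q t = - cmul (U t) (derive1 U t)
         - cmul (diff_mx a L N 1 *m U t) (diff_mx a L N 1 *m derive1 U t)) :
  let E := fun t : R => inner_h L (U t) (Q t) in
  forall t : R, t \in J -> derivable E t 1 /\ derive1 E t = 0.
Proof.
move=> E t tJ.
have dE := is_derive_inner_h L U Q t (derU t tJ) (derQ t tJ).
split; first exact: ex_derive.
rewrite derive1E (derive_val (df := _)) (eqQ t tJ).
move: (eqU t tJ); set W := (X in D_mx a L N *m X) => eqW.
(* The identity is linear in the time derivative of [U] and holds for any [V] in its place; the
   equation for [U] is used only afterwards, with [V = D W]. *)
suff -> : forall V : 'cV[R]_N, inner_h L V (Q t) + inner_h L (U t)
    (- cmul (U t) V
      - cmul (diff_mx a L N 1 *m U t) (diff_mx a L N 1 *m V)) =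
    inner_h L W V.
  by rewrite eqW inner_h_skew0 // D_mx_skew // gt_eqF.
move=> V; rewrite (inner_hC _ W) /W !inner_hDr !inner_hNr -addrA.
congr (_ + (- _ + _)); first by rewrite inner_h_cmul inner_hC.
(* Moving [D_1] off [V] produces a sign that cancels the minus in the equation for [Q]. *)
by rewrite inner_h_cmul (inner_h_skew _ _ _ _ (diff_mx1_skew a L N)) opprK.
Qed.
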